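(* Assume the parameters $\{p_t\}$, $\{\theta_t\}$ of the prox-sliding procedure are $p_t=\frac t2$ and $\theta_t=\frac{2(t+1)}{t(t+3)}$ for all $t\ge1$, and that there exists $\mathcal{D}_X>0$ such that $V(x,y)\le \mathcal{D}_X$ for all $x,y\in X$. Let $\{\beta_k\},\{\gamma_k\},\{T_k\}$ in the gradient sliding (GS) algorithm be $$\beta_k=\frac{2L}{\nu k},\qquad \gamma_k=\frac{2}{k+1},\qquad T_k=\left\lceil\frac{M^2Nk^2}{\tilde D L^2}\right\rceil,\qquad \tilde D=\frac{3\mathcal{D}_X}{2\nu},$$ for a suitable iteration limit $N$. Then the total numbers of evaluations of $\nabla f$ and of $h'$ required by the GS algorithm to find an $\epsilon$-solution of the composite problem (a point $\bar x\in X$ with $\Psi(\bar x)-\Psi^*\le\epsilon$) can be bounded by $$\mathcal{O}\left(\sqrt{\frac{L\mathcal{D}_X}{\nu\epsilon}}\right)\qquad\text{and}\qquad \mathcal{O}\left\{\frac{M^2\mathcal{D}_X}{\nu\epsilon^2}+\sqrt{\frac{L\mathcal{D}_X}{\nu\epsilon}}\right\},$$ respectively. Moreover, these two complexity bounds also hold if $X$ is bounded and $\{\beta_k\},\{\gamma_k\},\{T_k\}$ are set instead to $$\beta_k=\frac{9L(1-P_{T_k})}{2\nu(k+1)},\qquad \gamma_k=\frac{3}{k+2},\qquad T_k=\left\lceil\frac{M^2(k+1)^3}{\tilde D L^2}\right\rceil,\qquad \tilde D=\frac{81\mathcal{D}_X}{16\nu}.$$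
   Context: Problem. $\|\cdot\|$ is an arbitrary norm on $\mathbb{R}^n$ with dual norm $\|\cdot\|_*$. $X\subseteq\mathbb{R}^n$ is closed and convex, and $\Psi^*=\min_{x\in X}\{\Psi(x):=f(x)+h(x)+\mathcal{X}(x)\}$, where $f,h,\mathcal{X}:X\to\mathbb{R}$ are convex, $\mathcal X$ is simple, $f$ is differentiable, and for constants $L,M>0$, for all $x,y\in X$: $f(x)\le f(y)+\langle\nabla f(y),x-y\rangle+\frac L2\|x-y\|^2$ and $h(x)\le h(y)+\langle h'(y),x-y\rangle+M\|x-y\|$, where $h'(y)\in\partial h(y)$ is the subgradient that can be computed at $y$. An optimal solution is assumed to exist. Prox-function. $\omega:X\to\mathbb{R}$ is continuously differentiable with $\langle x-z,\nabla\omega(x)-\nabla\omega(z)\rangle\ge\nu\|x-z\|^2$ for all $x,z\in X$ ($\nu>0$), and $V(x,z)=\omega(z)-[\omega(x)+\langle\nabla\omega(x),z-x\rangle]$. Minimization subproblems below are assumed solvable. Notation. $l_f(x,y)=f(x)+\langle\nabla f(x),y-x\rangle$, $l_h(x,y)=h(x)+\langle h'(x),y-x\rangle$; $P_0=1$, $P_t=\frac{p_t}{1+p_t}P_{t-1}$ for $t\ge1$ (so $P_t=\frac{2}{(t+1)(t+2)}$ when $p_t=t/2$). GS algorithm. Input $x_0\in X$ and $N$; $\bar x_0=x_0$. For $k=1,\dots,N$: set $\underline x_k=(1-\gamma_k)\bar x_{k-1}+\gamma_kx_{k-1}$ and $g_k(\cdot)=l_f(\underline x_k,\cdot)$; compute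 $(x_k,\tilde x_k)=\mathrm{PS}(g_k,x_{k-1},\beta_k,T_k)$; set $\bar x_k=(1-\gamma_k)\bar x_{k-1}+\gamma_k\tilde x_k$. Output $\bar x_N$. Prox-sliding procedure $\mathrm{PS}(g,x,\beta,T)$: set $u_0=\tilde u_0=x$; for $t=1,\dots,T$ set $u_t=\arg\min_{u\in X}\{g(u)+l_h(u_{t-1},u)+\beta V(x,u)+\beta p_tV(u_{t-1},u)+\mathcal{X}(u)\}$ and $\tilde u_t=(1-\theta_t)\tilde u_{t-1}+\theta_tu_t$; return $(u_T,\tilde u_T)$. Each outer iteration $k$ uses one evaluation of $\nabla f$ and $T_k$ evaluations of $h'$, so a run with limit $N$ uses $N$ evaluations of $\nabla f$ and $\sum_{k=1}^NT_k$ evaluations of $h'$. The $\mathcal{O}(\cdot)$ bounds mean: there are absolute constants such that, for all sufficiently small $\epsilon>0$ (the threshold may depend on the problem data), one can choose $N$ so that $\bar x_N$ is an $\epsilon$-solution and the numbers of evaluations are at most the constants times the displayed expressions. *)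

(* Defs.v *)
(* MathComp / MathComp-Analysis *)
From HB Require Import structures.
From mathcomp Require Import all_boot all_order all_algebra.
From mathcomp Require Import all_classical all_reals all_analysis.

Set Implicit Arguments.
Unset Strict Implicit.
Unset Printing Implicit Defensive.

Import Order.TTheory GRing.Theory Num.Theory.
Import numFieldNormedType.Exports.

Local Open Scope classical_set_scope.
Local Open Scope ring_scope.

Section General.
Context {R : realType} {n : nat}.
Local Notation V := 'rV[R]_n.

Record is_norm (nrm : V -> R) : Prop := IsNorm {
  is_norm_triangle : forall x y, nrm (x + y) <= nrm x + nrm y ;
  is_norm_scale : forall (a : R) x, nrm (a *: x) = `|a| * nrm x ;
  is_norm_definite : forall x, nrm x = 0 -> x = 0 }.

Definition dot (u v : V) : R := \sum_(i < n) u 0 i * v 0 i.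

(* [df] is a gradient of [f] relative to [X]: the limit is taken along points
   of [X] only, as [f] is a function on [X]. When [X] has empty interior such a
   gradient need not be unique, and [df] is any fixed choice of it. The norm
   used here is the canonical (sup) norm of 'rV_n; any other norm gives the
   same notion. *)
Definition is_gradient_on (X : set V) (f : V -> R) (df : V -> V) : Prop :=
  forall x, X x ->
    (fun y => (f y - f x - dot (df x) (y - x)) / `|y - x|)
      @ within X x^' --> (0 : R).

Definition subdifferential (X : set V) (h : V -> R) (y : V) : set V :=
  [set g | forall x, X x -> h y + dot g (x - y) <= h x].

Definition linearization (f : V -> R) (df : V -> V) (x y : V) : R :=
  f x + dot (df x) (y - x).

Definition is_argmin (X : set V) (F : V -> R) (u : V) : Prop :=
  X u /\ forall v, X v -> F u <= F v.

End General.

(* The functions below are total on 'rV_n, but only their values on [dom]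
   matter. [sgh y] is the subgradient of [h] computed at [y]. *)
Record instance (R : realType) (n : nat) := Instance {
  dom : set 'rV[R]_n ;
  nrm : 'rV[R]_n -> R ;
  f : 'rV[R]_n -> R ;
  gradf : 'rV[R]_n -> 'rV[R]_n ;
  h : 'rV[R]_n -> R ;
  sgh : 'rV[R]_n -> 'rV[R]_n ;
  chi : 'rV[R]_n -> R ;
  omega : 'rV[R]_n -> R ;
  gradomega : 'rV[R]_n -> 'rV[R]_n ;
  L : R ;
  M : R ;
  nu : R }.

Section Algorithm.
Context {R : realType} {n : nat} (I : instance R n).
Local Notation V := 'rV[R]_n.
Local Notation X := (dom I).
Implicit Types (x y z u : V) (p theta beta gamma : nat -> R).

Definition Psi x : R := f I x + h I x + chi I x.

(* a minimum whenever an optimal solution exists *)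
Definition Psi_star : R := inf (Psi @` X).

Definition eps_solution (eps : R) (y : V) : Prop :=
  X y /\ Psi y - Psi_star <= eps.

Record standing_assumptions : Prop := StandingAssumptions {
  norm_nrm : is_norm (nrm I) ;
  closed_dom : closed X ;
  convex_dom : convex_set X ;
  convex_f : convex_function X (f I) ;
  convex_h : convex_function X (h I) ;
  convex_chi : convex_function X (chi I) ;
  L_gt0 : 0 < L I ;
  M_gt0 : 0 < M I ;
  nu_gt0 : 0 < nu I ;
  gradient_f : is_gradient_on X (f I) (gradf I) ;
  smooth_f : forall x y, X x -> X y ->
    f I x <= f I y + dot (gradf I y) (x - y) + L I / 2 * nrm I (x - y) ^+ 2 ;
  subgradient_h : forall y, X y -> subdifferential X (h I) y (sgh I y) ;
  lipschitz_h : forall x y, X x -> X y ->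
    h I x <= h I y + dot (sgh I y) (x - y) + M I * nrm I (x - y) ;
  optimal_exists : exists xs, is_argmin X Psi xs ;
  gradient_omega : is_gradient_on X (omega I) (gradomega I) ;
  continuous_gradomega : {within X, continuous (gradomega I)} ;
  strongly_monotone : forall x z, X x -> X z ->
    nu I * nrm I (x - z) ^+ 2
      <= dot (x - z) (gradomega I x - gradomega I z) }.

(* the prox-function V(x, z) *)
Definition prox x z : R :=
  omega I z - (omega I x + dot (gradomega I x) (z - x)).

Definition l_f := linearization (f I) (gradf I).
Definition l_h := linearization (h I) (sgh I).

Fixpoint Pseq p (t : nat) : R :=
  if t is s.+1 then p t / (1 + p t) * Pseq p s else 1.

(* objective of the [t]-th prox-sliding step, with q = p_t, u' = u_(t-1) *)
Definition ps_objective (g : V -> R) x (b q : R) u' u : R :=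
  g u + l_h u' u + b * prox x u + b * q * prox u' u + chi I u.

Definition subproblems_solvable p : Prop :=
  forall y x u' (b : R) (t : nat), X y -> X x -> X u' -> 0 < b -> (0 < t)%N ->
    exists u, is_argmin X (ps_objective (l_f y) x b (p t) u') u.

(* [PS p theta g x b T (v, w)] : (v, w) is a possible return value of
   PS(g, x, b, T) *)
Definition PS p theta (g : V -> R) x (b : R) (T : nat) (out : V * V) : Prop :=
  exists u ut : nat -> V,
    [/\ u 0%N = x, ut 0%N = x,
        forall t, (1 <= t <= T)%N ->
          is_argmin X (ps_objective g x b (p t) (u t.-1)) (u t) /\
          ut t = (1 - theta t) *: ut t.-1 + theta t *: u t
      & out = (u T, ut T)].

Definition GS_output p theta beta gamma (T : nat -> nat) (N : nat) x0 (y : V)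
    : Prop :=
  exists x xt xbar : nat -> V,
    [/\ x 0%N = x0, xbar 0%N = x0,
        forall k, (1 <= k <= N)%N ->
          let xu := (1 - gamma k) *: xbar k.-1 + gamma k *: x k.-1 in
          PS p theta (l_f xu) (x k.-1) (beta k) (T k) (x k, xt k) /\
          xbar k = (1 - gamma k) *: xbar k.-1 + gamma k *: xt k
      & y = xbar N].

Definition gradf_evals (N : nat) : nat := (\sum_(1 <= k < N.+1) 1)%N.
Definition sgh_evals (T : nat -> nat) (N : nat) : nat :=
  (\sum_(1 <= k < N.+1) T k)%N.

(* [beta N], [gamma N], [T N] are the parameters of a run with iteration limit
   [N]. The conjunct [exists y, GS_output .. y] says that the run does not get
   stuck. *)
Definition GS_complexity p theta (beta gamma : nat -> nat -> R)
    (T : nat -> nat -> nat) (grad_bound subgrad_bound : R -> R) : Prop :=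
  exists2 eps0 : R, 0 < eps0 & forall eps, 0 < eps -> eps < eps0 ->
    exists N : nat,
      [/\ (0 < N)%N,
          forall x0, X x0 ->
            (exists y, GS_output p theta (beta N) (gamma N) (T N) N x0 y) /\
            (forall y, GS_output p theta (beta N) (gamma N) (T N) N x0 y ->
               eps_solution eps y),
          (gradf_evals N)%:R <= grad_bound eps
        & (sgh_evals (T N) N)%:R <= subgrad_bound eps].

End Algorithm.

Definition p_ps (R : realType) (t : nat) : R := t%:R / 2.

Definition theta_ps (R : realType) (t : nat) : R :=
  (2 * (t + 1))%N%:R / (t * (t + 3))%N%:R.

(* only used for nonnegative arguments *)
Definition nceil (R : realType) (a : R) : nat := `|Num.ceil a|%N.

Section Schedules.
Context {R : realType} {n : nat} (I : instance R n) (DX : R).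

Definition Dt1 : R := 3 * DX / (2 * nu I).
Definition T1 (N k : nat) : nat :=
  nceil (M I ^+ 2 * N%:R * k%:R ^+ 2 / (Dt1 * L I ^+ 2)).
Definition beta1 (k : nat) : R := 2 * L I / (nu I * k%:R).
Definition gamma1 (k : nat) : R := 2 / (k + 1)%N%:R.

Definition Dt2 : R := 81 * DX / (16 * nu I).
Definition T2 (k : nat) : nat :=
  nceil (M I ^+ 2 * (k + 1)%N%:R ^+ 3 / (Dt2 * L I ^+ 2)).
Definition beta2 (k : nat) : R :=
  9 * L I * (1 - Pseq (@p_ps R) (T2 k)) / (2 * nu I * (k + 1)%N%:R).
Definition gamma2 (k : nat) : R := 3 / (k + 2)%N%:R.

End Schedules.

(* Main.v *)
(* One prox-sliding step satisfies a three-point inequality, because its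
   objective is a convex function plus [beta (1 + p_t) omega]. Weighting step [t]
   by [t + 1] telescopes the prox-functions and turns the averages [ut] into
   convex combinations; the linearization error [M |u_t - u_(t-1)|] is absorbed by
   the strong convexity of [V]. So PS solves its subproblem up to
   [4 M^2 / (nu beta (T + 3))]. Inserted in the accelerated-gradient recursion for
   [Psi (xbar k) - Psi z], with weights [k (k + 1)] (first schedule) or
   [k (k + 1) (k + 2)] (second schedule), this gives
   [N^2 (Psi (xbar N) - Psi z) <= 36 L D / nu]. One then takes
   [N = ceil (6 sqrt (L D / (nu eps)))]. *)

Require Import Defs.
From mathcomp Require Import all_boot all_order all_algebra ring lra zify.
From mathcomp Require Import all_classical all_reals all_analysis.
Import Order.TTheory GRing.Theory Num.Theory.
Import numFieldNormedType.Exports.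
Local Open Scope classical_set_scope.
Local Open Scope ring_scope.

Section Convexity.
Context {R : realType} {n : nat}.
Implicit Types (X : set 'rV[R]_n) (F : 'rV[R]_n -> R) (x y z : 'rV[R]_n).

Lemma dotDr x y z : dot x (y + z) = dot x y + dot x z.
Proof.
by rewrite /dot -big_split; apply: eq_bigr => i _; rewrite mxE mulrDr.
Qed.

Lemma dotZr (a : R) x y : dot x (a *: y) = a * dot x y.
Proof.
by rewrite /dot mulr_sumr; apply: eq_bigr => i _; rewrite mxE mulrCA.
Qed.

Lemma dotNr x y : dot x (- y) = - dot x y.
Proof. by rewrite -scaleN1r dotZr mulN1r. Qed.

Lemma dot0r x : dot x 0 = 0.
Proof. by rewrite -(scale0r 0) dotZr mul0r. Qed.

Lemma dotBr x y z : dot x (y - z) = dot x y - dot x z.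
Proof. by rewrite dotDr dotNr. Qed.

Lemma dotC x y : dot x y = dot y x.
Proof. by apply: eq_bigr => i _; rewrite mulrC. Qed.

Lemma dotBl x y z : dot (x - y) z = dot x z - dot y z.
Proof. by rewrite dotC dotBr !(dotC z). Qed.

Lemma segmentE x y (s : R) : x + s *: (y - x) = (1 - s) *: x + s *: y.
Proof. by rewrite scalerBr scalerBl scale1r addrA addrAC. Qed.

Lemma convex_setE X x y (a : R) : convex_set X -> X x -> X y ->
  0 <= a <= 1 -> X ((1 - a) *: x + a *: y).
Proof.
move=> cX Xx Xy a01.
have a01' : Itv.spec (@Itv.num_sem R)
    (Itv.Real (Interval (BLeft 0%Z) (BRight 1%Z))) a.
  by rewrite /Itv.spec/= /Itv.num_sem/= in_itv/= a01 num_real.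
have := @cX y x (Itv.mk a01'); rewrite !inE => /(_ Xy Xx).
by rewrite addrC.
Qed.

Lemma convex_functionE X F x y (a : R) : convex_function X F -> X x -> X y ->
  0 <= a <= 1 -> F ((1 - a) *: x + a *: y) <= (1 - a) * F x + a * F y.
Proof.
move=> cF Xx Xy a01.
have a01' : Itv.spec (@Itv.num_sem R)
    (Itv.Real (Interval (BLeft 0%Z) (BRight 1%Z))) a.
  by rewrite /Itv.spec/= /Itv.num_sem/= in_itv/= a01 num_real.
have := @cF (Itv.mk a01') y x; rewrite !inE => /(_ Xy Xx).
by rewrite /conv/= addrC [leRHS]addrC.
Qed.

Lemma gradient_expansion X F dF x : is_gradient_on X F dF -> X x ->
  forall e : R, 0 < e -> exists2 delta : R, 0 < delta &
    forall y, X y -> `|y - x| < delta ->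
      `|F y - F x - dot (dF x) (y - x)| <= e * `|y - x|.
Proof.
move=> gF Xx e e0.
have /cvgrPdist_le/(_ e e0) := gF x Xx.
rewrite !near_withinE => /nbhs_normP[d d0 Hd]; exists d => // y Xy yd.
have [->|yx] := eqVneq y x; first by rewrite !subrr dot0r subr0 !normr0 mulr0.
have := Hd y; rewrite /= distrC => /(_ yd yx Xy).
by rewrite sub0r normrN normrM normfV normr_id ler_pdivrMr// normr_gt0 subr_eq0.
Qed.

Lemma gradient_expansion_ray X F dF x d : is_gradient_on X F dF -> X x ->
  forall e : R, 0 < e -> exists2 delta : R, 0 < delta &
    forall t : R, X (x + t *: d) -> `|t| < delta ->
      `|F (x + t *: d) - F x - t * dot (dF x) d| <= e * `|t|.
Proof.
move=> gF Xx e e0.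
have d0 : 0 < 1 + `|d| by rewrite ltr_pwDl.
have [|delta delta0 Hd] := gradient_expansion X F dF x gF Xx (e / (1 + `|d|)).
  by rewrite divr_gt0.
exists (delta / (1 + `|d|)); first by rewrite divr_gt0.
move=> t Xt td; have := Hd _ Xt.
rewrite [x + _]addrC addrK dotZr normrZ addrC => H.
apply: (le_trans (H _)).
  apply: le_lt_trans (_ : `|t| * (1 + `|d|) < _); last by rewrite -ltr_pdivlMr.
  by rewrite ler_wpM2l// lerDr.
rewrite mulrAC ler_pdivrMr// -[leRHS]mulrA ler_pM2l//.
by rewrite ler_wpM2l// lerDr.
Qed.

Lemma gradient_le X F dF x y (A : R) :
  convex_set X -> is_gradient_on X F dF -> X x -> X y ->
  (forall s : R, 0 < s <= 1 -> F (x + s *: (y - x)) - F x <= s * A) ->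
  dot (dF x) (y - x) <= A.
Proof.
move=> cX gF Xx Xy H; apply/ler_addgt0Pr => e e0.
have [delta d0 Hd] := gradient_expansion_ray _ _ _ _ (y - x) gF Xx e e0.
pose s := Num.min 1 (delta / 2).
have s0 : 0 < s by rewrite lt_min ltr01 divr_gt0.
have s1 : s <= 1 by rewrite ge_min lexx.
have sd : s < delta by rewrite gt_min; apply/orP; right; lra.
have Xs : X (x + s *: (y - x)).
  rewrite segmentE.
  by apply: convex_setE => //; rewrite ltW.
have := Hd s Xs; rewrite gtr0_norm// => /(_ sd).
have := H s; rewrite s0 s1 => /(_ isT).
rewrite ler_norml => h1 /andP[h2 h3].
have : s * dot (dF x) (y - x) <= s * (A + e) by lra.
by rewrite ler_pM2l.
Qed.

Lemma gradient_ge X F dF x y (A : R) :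
  convex_set X -> is_gradient_on X F dF -> X x -> X y ->
  (forall s : R, 0 < s <= 1 -> s * A <= F (x + s *: (y - x)) - F x) ->
  A <= dot (dF x) (y - x).
Proof.
move=> cX gF Xx Xy H; rewrite -lerN2 -dotNr -scaleN1r dotZr mulN1r.
have gNF : is_gradient_on X (fun u => - F u) (fun u => - dF u).
  move=> u Xu; have := gF u Xu.
  have -> : (fun v => (- F v - - F u - dot (- dF u) (v - u)) / `|v - u|) =
     - (fun v => (F v - F u - dot (dF u) (v - u)) / `|v - u|).
    apply/funext => v; rewrite fctE -mulNr; congr (_ / _).
    by rewrite dotC dotNr dotC; lra.
  by move=> /cvgN; rewrite oppr0.
have := @gradient_le X _ _ x y (- A) cX gNF Xx Xy.
rewrite dotC dotNr dotC; apply => s /H; lra.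
Qed.

Lemma convex_gradient X F dF x y : convex_set X -> convex_function X F ->
  is_gradient_on X F dF -> X x -> X y -> F x + dot (dF x) (y - x) <= F y.
Proof.
move=> cX cF gF Xx Xy; rewrite -lerBrDl.
apply: (gradient_le _ _ _ _ _ _ cX gF Xx Xy) => s /andP[s0 s1].
rewrite segmentE.
have := convex_functionE X F x y s cF Xx Xy; rewrite ltW// s1 => /(_ isT); lra.
Qed.

End Convexity.

Section StrongConvexity.
Context {R : realType}.

Lemma is_derive_expansion (g : R -> R) (s l : R) :
  (forall e : R, 0 < e -> exists2 delta : R, 0 < delta &
    forall t, `|t| < delta -> `|g (s + t) - g s - t * l| <= e * `|t|) ->
  is_derive s 1 g l.
Proof.
move=> H.
have cvl : h^-1 *: ((g \o shift s) (h *: (1 : R)) - g s) @[h --> 0^'] --> l.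
  apply/cvgrPdist_le => e e0; have [d d0 Hd] := H e e0.
  rewrite near_withinE; apply/nbhs_normP; exists d => // t.
  rewrite /= sub0r normrN => td t0.
  have := Hd t td; rewrite -[_ *: 1]/(t * 1) mulr1 [t + s]addrC => Ht.
  rewrite distrC -[_ *: _]/(t^-1 * _).
  have -> : t^-1 * (g (s + t) - g s) - l = t^-1 * (g (s + t) - g s - t * l).
    by rewrite [RHS]mulrBr mulKf.
  by rewrite normrM normfV mulrC ler_pdivrMr// normr_gt0.
by apply: DeriveDef; [apply/cvg_ex; exists l|apply/cvg_lim].
Qed.

Lemma continuous_expansion (g : R -> R) (a b s l : R) : a <= s <= b ->
  (forall e : R, 0 < e -> exists2 delta : R, 0 < delta &
    forall t, a <= s + t <= b -> `|t| < delta ->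
      `|g (s + t) - g s - t * l| <= e * `|t|) ->
  g x @[x --> within `[a, b] (nbhs s)] --> g s.
Proof.
move=> sab H; apply/cvgrPdist_le => e e0.
have [d d0 Hd] := H 1 ltr01.
have l1 : 0 < 1 + `|l| by rewrite ltr_pwDl.
rewrite near_withinE; apply/nbhs_normP.
exists (Num.min d (e / (1 + `|l|))); first by rewrite /= lt_min d0 divr_gt0.
move=> u; rewrite /= in_itv/= distrC lt_min => /andP[ud ue] uab.
have := Hd (u - s); rewrite addrCA subrr addr0 => /(_ uab ud) Hu.
have -> : g s - g u = - ((g u - g s - (u - s) * l) + (u - s) * l) by lra.
rewrite normrN; apply: le_trans (ler_normD _ _) _.
rewrite normrM; move: ue; rewrite ltr_pdivlMr//; lra.
Qed.

Lemma nondecreasing_expansion (g dg : R -> R) :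
  (forall s, 0 <= s <= 1 -> 0 <= dg s) ->
  (forall s, 0 <= s <= 1 -> forall e : R, 0 < e -> exists2 delta : R, 0 < delta &
    forall t, 0 <= s + t <= 1 -> `|t| < delta ->
      `|g (s + t) - g s - t * dg s| <= e * `|t|) ->
  g 0 <= g 1.
Proof.
move=> dg0 H.
have [|| c] := @MVT_segment R g dg 0 1 ler01.
- move=> s; rewrite in_itv/= => /andP[s0 s1].
  apply: is_derive_expansion => e e0.
  have [|d d0 Hd] := H s _ e e0; first by rewrite !ltW.
  exists (Num.min d (Num.min s (1 - s))); first by rewrite !lt_min d0 s0 subr_gt0.
  move=> t; rewrite !lt_min => /and3P[td ts ts1]; apply: Hd => //.
  by move: ts ts1; rewrite !ltr_norml => /andP[? ?] /andP[? ?]; lra.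
- apply/subspace_continuousP => s; rewrite /= in_itv/= => s01.
  by apply: (@continuous_expansion g 0 1 s (dg s)) => //; exact: H.
- rewrite in_itv/= => c01; rewrite subr0 mulr1 => g01.
  by rewrite -subr_ge0 g01 dg0.
Qed.

Lemma strong_monotone_gradient n (X : set 'rV[R]_n) F dF x z (q : R) :
  convex_set X -> is_gradient_on X F dF -> X x -> X z ->
  (forall s : R, 0 <= s <= 1 ->
    s * q <= dot (dF (x + s *: (z - x)) - dF x) (z - x)) ->
  q / 2 <= F z - (F x + dot (dF x) (z - x)).
Proof.
move=> cX gF Xx Xz Hq; set d := z - x.
have Xs s : 0 <= s <= 1 -> X (x + s *: d).
  move=> s01; rewrite segmentE.
  exact: convex_setE.
pose g s := F (x + s *: d) - s * dot (dF x) d - s ^+ 2 * q / 2.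
pose dg s := dot (dF (x + s *: d)) d - dot (dF x) d - s * q.
suff : g 0 <= g 1.
  by rewrite /g scale0r addr0 scale1r (addrC x d) subrK; lra.
apply: (@nondecreasing_expansion g dg) => s s01.
  by have := Hq s s01; rewrite dotBl /dg subr_ge0.
move=> e e0; have e2 : 0 < e / 2 by rewrite divr_gt0.
have [dl dl0 Hd] := gradient_expansion_ray _ _ _ _ d gF (Xs s s01) _ e2.
have q1 : 0 < 1 + `|q| by rewrite ltr_pwDl.
exists (Num.min dl (e / (1 + `|q|))); first by rewrite lt_min dl0 divr_gt0.
move=> t st01; rewrite lt_min ltr_pdivlMr// => /andP[tdl te].
have := Hd t; rewrite -addrA -scalerDl => /(_ (Xs _ st01) tdl) Ht.
have -> : g (s + t) - g s - t * dg s =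
   (F (x + (s + t) *: d) - F (x + s *: d) - t * dot (dF (x + s *: d)) d)
   - (t * t * q / 2) by rewrite /g /dg; field.
apply: le_trans (ler_normB _ _) _.
rewrite !normrM (ger0_norm (_ : 0 <= 2^-1))//.
have := normr_ge0 t; have := normr_ge0 q; nra.
Qed.

End StrongConvexity.

Section ProxSliding.
Context {R : realType} {n : nat} (I : instance R n).
Hypothesis H : standing_assumptions I.
Local Notation X := (dom I).
Implicit Types (x y z u v w : 'rV[R]_n) (a b c : R).

Let cX : convex_set X := convex_dom H.

Lemma nrm_ge0 x : 0 <= nrm I x.
Proof.
have nrmN : nrm I (- x) = nrm I x.
  by rewrite -scaleN1r (is_norm_scale (norm_nrm H)) normrN1 mul1r.
have nrm0 : nrm I 0 = 0.
  by rewrite -(scale0r 0) (is_norm_scale (norm_nrm H)) normr0 mul0r.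
have := is_norm_triangle (norm_nrm H) x (- x).
by rewrite subrr nrm0 nrmN; lra.
Qed.

Lemma prox_strong x z : X x -> X z ->
  nu I / 2 * nrm I (z - x) ^+ 2 <= prox I x z.
Proof.
move=> Xx Xz; rewrite mulrAC.
apply: (strong_monotone_gradient _ X _ _ _ _ _ cX (gradient_omega H)) => //.
move=> s s01; have [->|s0] := eqVneq s 0.
  by rewrite mul0r scale0r addr0 subrr dotC dot0r.
have Xs : X (x + s *: (z - x)).
  rewrite segmentE.
  exact: convex_setE.
have sp : 0 < s by rewrite lt_def s0; case/andP: s01.
have := strongly_monotone H Xs Xx.
rewrite (addrC x) addrK (is_norm_scale (norm_nrm H)) dotC dotZr gtr0_norm//.
by rewrite exprMn mulrCA expr2 -mulrA ler_pM2l.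
Qed.

Lemma prox_ge0 x z : X x -> X z -> 0 <= prox I x z.
Proof.
move=> Xx Xz; apply: le_trans (prox_strong x z Xx Xz).
by rewrite mulr_ge0 ?exprn_ge0 ?nrm_ge0// divr_ge0// ltW// nu_gt0.
Qed.

Lemma omega_convex x y a : X x -> X y -> 0 <= a <= 1 ->
  omega I ((1 - a) *: x + a *: y) <= (1 - a) * omega I x + a * omega I y.
Proof.
move=> Xx Xy a01; set w := (1 - a) *: x + a *: y.
have Xw : X w by exact: convex_setE.
have := prox_ge0 w x Xw Xx; have := prox_ge0 w y Xw Xy.
rewrite /prox !dotBr; set g := gradomega I w.
have -> : dot g w = (1 - a) * dot g x + a * dot g y by rewrite dotDr !dotZr.
by move: a01 => /andP[a0 a1]; nra.
Qed.

Lemma argmin_three_point (G : 'rV[R]_n -> R) c u v : 0 <= c ->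
  (forall w a, X w -> 0 <= a <= 1 ->
    G ((1 - a) *: u + a *: w) <= (1 - a) * G u + a * G w) ->
  is_argmin X (fun w => G w + c * omega I w) u -> X v ->
  G u + c * omega I u + c * prox I u v <= G v + c * omega I v.
Proof.
move=> c0 cG [Xu umin] Xv.
have [c00|cn0] := eqVneq c 0.
  by have := umin v Xv; rewrite c00; lra.
have cp : 0 < c by rewrite lt_def cn0.
have : (G u - G v) / c <= dot (gradomega I u) (v - u).
  apply: (gradient_ge _ _ _ _ _ _ cX (gradient_omega H) Xu Xv) => s /andP[s0 s1].
  rewrite segmentE.
  have s01 : 0 <= s <= 1 by rewrite ltW.
  have := cG v s Xv s01; have := umin _ (convex_setE _ _ _ _ cX Xu Xv s01).
  rewrite mulrA ler_pdivrMr//; nra.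
by rewrite ler_pdivrMr// /prox; nra.
Qed.

Definition phi y x b v := l_f I y v + h I v + chi I v + b * prox I x v.

Lemma ps_objective_three_point y x u' b q u v : X x -> X u' -> 0 < b -> 0 <= q ->
  is_argmin X (ps_objective I (l_f I y) x b q u') u -> X v ->
  ps_objective I (l_f I y) x b q u' u + b * (1 + q) * prox I u v
    <= ps_objective I (l_f I y) x b q u' v.
Proof.
move=> Xx Xu' b0 q0 umin Xv.
pose G w := ps_objective I (l_f I y) x b q u' w - b * (1 + q) * omega I w.
have E : ps_objective I (l_f I y) x b q u'
    = (fun w => G w + b * (1 + q) * omega I w).
  by apply/funext => w; rewrite /G subrK.
have Xu : X u by case: umin.
have := @argmin_three_point G (b * (1 + q)) u v.
rewrite -[G u + _]/((fun w => G w + b * (1 + q) * omega I w) u) -E.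
rewrite -[G v + _]/((fun w => G w + b * (1 + q) * omega I w) v) -E.
apply => //; first by apply: mulr_ge0; [exact: ltW|exact: addr_ge0].
move=> w a Xw a01.
have := convex_functionE _ _ _ _ _ (convex_chi H) Xu Xw a01.
rewrite /G /ps_objective /l_f /l_h /linearization /prox !dotBr !dotDr !dotZr.
lra.
Qed.

Lemma phi_step y x u' b q u v : X x -> X u' -> 0 < b -> 0 < q ->
  is_argmin X (ps_objective I (l_f I y) x b q u') u -> X v ->
  phi y x b u - phi y x b v
    <= b * q * prox I u' v - b * (1 + q) * prox I u v
       + M I ^+ 2 / (2 * nu I * b * q).
Proof.
move=> Xx Xu' b0 q0 umin Xv; have Xu : X u by case: umin.
have := ps_objective_three_point _ _ _ _ _ _ _ Xx Xu' b0 (ltW q0) umin Xv.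
have := lipschitz_h H Xu Xu'.
have := subgradient_h H Xu' Xv.
have := prox_strong _ _ Xu' Xu.
rewrite /phi /ps_objective /l_h /linearization.
set r := nrm I _; set V := prox I u' u => hV h1 h2 h3.
have nu0 := nu_gt0 H.
suff : M I * r - b * q * V <= M I ^+ 2 / (2 * nu I * b * q) by nra.
have bq : 0 < b * q by exact: mulr_gt0.
have k0 : 0 < 2 * nu I * b * q by rewrite !mulr_gt0.
rewrite ler_pdivlMr//.
have hV' : b * q * (nu I / 2 * r ^+ 2) <= b * q * V by rewrite ler_pM2l.
have : (M I * r - b * q * V) * (2 * nu I * b * q)
    <= (M I * r - b * q * (nu I / 2 * r ^+ 2)) * (2 * nu I * b * q).
  by rewrite ler_pM2r// lerD2l lerN2.
have := sqr_ge0 (M I - nu I * b * q * r); nra.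
Qed.

Lemma phi_convex y x b u v a : X u -> X v -> 0 <= b -> 0 <= a <= 1 ->
  phi y x b ((1 - a) *: u + a *: v) <= (1 - a) * phi y x b u + a * phi y x b v.
Proof.
move=> Xu Xv b0 a01; rewrite /phi.
have := convex_functionE _ _ _ _ _ (convex_chi H) Xu Xv a01.
have := convex_functionE _ _ _ _ _ (convex_h H) Xu Xv a01.
have : b * omega I ((1 - a) *: u + a *: v)
    <= b * ((1 - a) * omega I u + a * omega I v).
  by rewrite ler_wpM2l// omega_convex.
rewrite /l_f /linearization /prox !dotBr !dotDr !dotZr; lra.
Qed.

Lemma theta_ps01 t : (0 < t)%N -> 0 <= @theta_ps R t <= 1.
Proof.
move=> t0; rewrite /theta_ps divr_ge0//= ler_pdivrMr ?mul1r ?ler_nat ?ltr0n; nia.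
Qed.

(* The [t]-th step is weighted by [t + 1], i.e. by [1 / P_t - 1 / P_(t-1)]; the
   weights add up to [S = T (T + 3) / 2 = 1 / P_T - 1]. *)
Lemma PS_bound y x b T v w : X y -> X x -> 0 < b ->
  PS I (@p_ps R) (@theta_ps R) (l_f I y) x b T (v, w) ->
  [/\ X v, X w & forall z, X z -> let S := T%:R * (T%:R + 3) / 2 in
    b * (S + 1) * prox I v z + S * (phi y x b w - phi y x b z)
      <= b * prox I x z + 2 * M I ^+ 2 * T%:R / (nu I * b)].
Proof.
move=> Xy Xx b0 [u [ut [u0 ut0 step [-> ->]]]].
suff : forall t, (t <= T)%N -> [/\ X (u t), X (ut t) &
    forall z, X z -> let S := t%:R * (t%:R + 3) / 2 in
    b * (S + 1) * prox I (u t) z + S * (phi y x b (ut t) - phi y x b z)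
      <= b * prox I x z + 2 * M I ^+ 2 * t%:R / (nu I * b)] by exact.
elim=> [_|t IH tT].
  rewrite u0 ut0; split=> // z Xz /=.
  by rewrite !(mul0r, mulr0, add0r, addr0, mulr1).
have [Xut Xutt IHz] := IH (ltnW tT).
have [/=umin ->] := step t.+1 tT.
have Xu1 : X (u t.+1) by case: umin.
have th01 : 0 <= @theta_ps R t.+1 <= 1 by exact: theta_ps01.
split=> [||z Xz] //; first exact: convex_setE.
set S := t.+1%:R * _ / 2.
have := phi_convex y x b _ _ _ Xutt Xu1 (ltW b0) th01.
have q0 : 0 < @p_ps R t.+1 by rewrite divr_gt0.
have := phi_step _ _ _ _ _ _ _ Xx Xut b0 q0 umin Xz.
have := IHz z Xz; rewrite {IHz}/=.
set A := phi _ _ _ z; set P := phi _ _ _ (u _); set Q := phi _ _ _ (ut _).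
set Z := phi _ _ _ _; set V := prox _ _ _; set V' := prox I (u t.+1) _.
have S0 : 0 <= S by rewrite /S divr_ge0 ?mulr_ge0 ?addr_ge0.
have Sth : S * @theta_ps R t.+1 = t%:R + 2.
  rewrite /S /theta_ps !natrM !natrD -natr1; field.
  have := ler0n R t; lra.
have SE : S = t%:R * (t%:R + 3) / 2 + (t%:R + 2) by rewrite /S -natr1; field.
have -> : @p_ps R t.+1 = (t%:R + 1) / 2 by rewrite /p_ps natr1.
have nu0 := nu_gt0 H.
have K0 : 0 <= M I ^+ 2 / (nu I * b) by rewrite divr_ge0 ?sqr_ge0// mulr_ge0 ?ltW.
set K := M I ^+ 2 / (nu I * b) in K0.
have -> : 2 * M I ^+ 2 * t%:R / (nu I * b) = 2 * K * t%:R.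
  by rewrite /K; field; rewrite !gt_eqF.
have -> : 2 * M I ^+ 2 * t.+1%:R / (nu I * b) = 2 * K * (t%:R + 1).
  by rewrite /K natr1; field; rewrite !gt_eqF.
have -> : M I ^+ 2 / (2 * nu I * b * ((t%:R + 1) / 2)) = K / (t%:R + 1).
  rewrite /K; field; rewrite !gt_eqF//; have := ler0n R t; lra.
move=> h1 h2 h3.
have t0 := ler0n R t.
have h3' : S * Z <= (S - (t%:R + 2)) * Q + (t%:R + 2) * P.
  by apply: le_trans (ler_wpM2l S0 h3) _; rewrite -Sth; lra.
have t2 : 0 <= t%:R + 2 :> R by lra.
have h4 : (t%:R + 2) * (K / (t%:R + 1)) <= 2 * K.
  rewrite mulrA ler_pdivrMr; nra.
have h2' := ler_wpM2l t2 h2.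
move: h1 h3'; rewrite SE; lra.
Qed.

End ProxSliding.

Section GradientSliding.
Context {R : realType} {n : nat} (I : instance R n).
Hypothesis H : standing_assumptions I.
Local Notation X := (dom I).
Implicit Types (x y z u v w : 'rV[R]_n) (a b c : R).

Let cX : convex_set X := convex_dom H.

(* [1 / (1 - P_T)] for [p_t = t / 2]; the value at [T = 0] is junk. *)
Definition inv_onemP (T : nat) : R := 1 + 2 / (T%:R * (T%:R + 3)).

Lemma GS_step xbar x x' xt z (gam b : R) T :
  let xu := (1 - gam) *: xbar + gam *: x in
  let xbar' := (1 - gam) *: xbar + gam *: xt in
  X xbar -> X x -> 0 <= gam <= 1 -> 0 < b -> (0 < T)%N ->
  L I * gam <= b * nu I ->
  PS I (@p_ps R) (@theta_ps R) (l_f I xu) x b T (x', xt) -> X z ->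
  [/\ X x', X xbar' & Psi I xbar' - Psi I z <=
    (1 - gam) * (Psi I xbar - Psi I z) +
    gam * (b * inv_onemP T * (prox I x z - prox I x' z)
           + 4 * M I ^+ 2 / (nu I * b * (T%:R + 3)))].
Proof.
move=> xu xbar' Xxbar Xx g01 b0 T0 Lg hPS Xz.
have Xxu : X xu by exact: convex_setE.
have [Xx' Xxt /(_ z Xz) /= hz] := PS_bound I H _ _ _ _ _ _ Xxu Xx b0 hPS.
have Xxbar' : X xbar' by exact: convex_setE.
split=> //; move: (g01) => /andP[g0 g1].
have T1 : 1 <= T%:R :> R by rewrite ler1n.
have nu0 := nu_gt0 H.
have TT0 : 0 < T%:R * (T%:R + 3) / 2 :> R by rewrite divr_gt0// mulr_gt0; lra.
have hphi : phi I xu x b xt - phi I xu x b z <=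
    b * prox I x z - b * inv_onemP T * prox I x' z
    + b * (inv_onemP T - 1) * prox I x z + 4 * M I ^+ 2 / (nu I * b * (T%:R + 3))
    - b * prox I x z.
  rewrite -(ler_pM2l TT0) -subr_ge0.
  move: hz; rewrite -subr_ge0 => /le_trans; apply.
  rewrite le_eqVlt; apply/orP; left; apply/eqP.
  rewrite /inv_onemP; field; rewrite !gt_eqF//; lra.
have hf : f I xbar' <= l_f I xu xbar' + L I / 2 * (gam ^+ 2 * nrm I (xt - x) ^+ 2).
  have := smooth_f H Xxbar' Xxu; rewrite /l_f /linearization.
  have -> : xbar' - xu = gam *: (xt - x).
    by rewrite /xbar' /xu scalerBr opprD addrACA subrr add0r.
  by rewrite (is_norm_scale (norm_nrm H)) exprMn real_normK ?num_real.
have cf w : X w -> l_f I xu w <= f I w.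
  by move=> Xw; exact: (convex_gradient X _ _ _ _ cX (convex_f H) (gradient_f H)).
have hV := ler_wpM2l (mulr_ge0 g0 (ltW b0)) (prox_strong I H _ _ Xx Xxt).
have hL : gam * (L I * gam) * (nrm I (xt - x) ^+ 2 / 2)
    <= gam * (b * nu I) * (nrm I (xt - x) ^+ 2 / 2).
  apply: ler_wpM2r; first by rewrite divr_ge0// sqr_ge0.
  exact: ler_wpM2l.
have hlin : l_f I xu xbar' = (1 - gam) * l_f I xu xbar + gam * l_f I xu xt.
  by rewrite /l_f /linearization /xbar' !dotBr !dotDr !dotZr; lra.
have hchi := convex_functionE _ _ _ _ _ (convex_chi H) Xxbar Xxt g01.
have hh := convex_functionE _ _ _ _ _ (convex_h H) Xxbar Xxt g01.
have hb : (1 - gam) * l_f I xu xbar <= (1 - gam) * f I xbar.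
  by rewrite ler_wpM2l ?cf// subr_ge0.
have hz' : gam * l_f I xu z <= gam * f I z by rewrite ler_wpM2l ?cf.
have {}hphi := ler_wpM2l g0 hphi.
move: hphi hh hchi hf; rewrite -/xbar' hlin /phi /Psi.
set E := 4 * _ / _; move: hV hL hb hz'; lra.
Qed.

Lemma inv_onemP_ge1 T : 1 <= inv_onemP T.
Proof. by rewrite lerDl divr_ge0// mulr_ge0// addr_ge0. Qed.

Lemma inv_onemP_le T : (0 < T)%N -> inv_onemP T <= 3 / 2.
Proof.
move=> T0; have T1 : 1 <= T%:R :> R by rewrite ler1n.
suff : 2 / (T%:R * (T%:R + 3)) <= 1 / 2 :> R by rewrite /inv_onemP; lra.
by rewrite ler_pdivrMr ?mulr_gt0//; nra.
Qed.

Lemma inv_onemP_nincr T T' : (0 < T <= T')%N -> inv_onemP T' <= inv_onemP T.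
Proof.
move=> /andP[T0 TT']; have T1 : 1 <= T%:R :> R by rewrite ler1n.
have TT : T%:R <= T'%:R :> R by rewrite ler_nat.
rewrite lerD2l ler_wpM2l// lef_pV2 ?posrE ?mulr_gt0//; nra.
Qed.

Lemma Pseq_p_ps T : Pseq (@p_ps R) T = 2 / ((T%:R + 1) * (T%:R + 2)).
Proof.
elim: T => [|T IH]; first by rewrite /= !add0r mul1r divff.
have T0 := ler0n R T.
rewrite [LHS]/= IH /p_ps -natr1; field; rewrite !gt_eqF//; lra.
Qed.

Lemma onem_Pseq T : (0 < T)%N -> (1 - Pseq (@p_ps R) T) * inv_onemP T = 1.
Proof.
move=> T0; have T1 : 1 <= T%:R :> R by rewrite ler1n.
rewrite Pseq_p_ps /inv_onemP; field; rewrite !gt_eqF//; lra.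
Qed.

Lemma nceil_ge (a : R) : 0 <= a -> a <= (nceil a)%:R.
Proof.
move=> a0; rewrite /nceil natr_absz ger0_norm ?ceil_ge//.
by rewrite -(ler_int R); apply: le_trans (ceil_ge a).
Qed.

Lemma nceil_lt (a : R) : 0 <= a -> (nceil a)%:R < a + 1.
Proof.
move=> a0; rewrite /nceil natr_absz ger0_norm.
  by have /andP[] := ceil_itv a; rewrite intrB; lra.
by rewrite -(ler_int R); apply: le_trans (ceil_ge a).
Qed.

Lemma nceil_gt0 (a : R) : 0 < a -> (0 < nceil a)%N.
Proof.
by move=> a0; rewrite -(ltr0n R) (lt_le_trans a0)// nceil_ge// ltW.
Qed.

Lemma le_nceil (a b : R) : 0 <= a -> a <= b -> (nceil a <= nceil b)%N.
Proof.
move=> a0 ab; have b0 := le_trans a0 ab.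
have : (nceil a)%:R < (nceil b).+1%:R :> R.
  by have := nceil_lt a a0; have := nceil_ge b b0; rewrite -natr1; lra.
by rewrite ltr_nat ltnS.
Qed.

End GradientSliding.

Section Runs.
Context {R : realType} {n : nat} (I : instance R n).
Hypothesis H : standing_assumptions I.
Local Notation X := (dom I).
Local Notation V := 'rV[R]_n.
Implicit Types (x y z : 'rV[R]_n).

Lemma PS_exists y x (b : R) T : subproblems_solvable I (@p_ps R) ->
  X y -> X x -> 0 < b ->
  exists out, PS I (@p_ps R) (@theta_ps R) (l_f I y) x b T out.
Proof.
move=> hS Xy Xx b0.
have /choice[next hnext] : forall tu : nat * V, exists u, (0 < tu.1)%N -> X tu.2 ->
    is_argmin X (ps_objective I (l_f I y) x b (p_ps R tu.1) tu.2) u.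
  move=> [t u']; have [[t0 Xu']|nX] := pselect ((0 < t)%N /\ X u').
    by have [u hu] := hS y x u' b t Xy Xx Xu' b0 t0; exists u.
  by exists x => /= t0 Xu'; case: nX.
pose u := fix u t := if t is s.+1 then next (t, u s) else x.
pose ut := fix ut t := if t is s.+1
  then (1 - theta_ps R t) *: ut s + theta_ps R t *: u t else x.
have Xu t : X (u t) by elim: t => //= t Xut; case: (hnext (t.+1, u t) isT Xut).
exists (u T, ut T), u, ut; split=> // -[//|t] _; split=> //.
by apply: (hnext (t.+1, u t)) => //; exact: Xu.
Qed.

Lemma GS_exists (beta gamma : nat -> R) (T : nat -> nat) N x0 :
  subproblems_solvable I (@p_ps R) -> X x0 ->
  (forall k, (1 <= k <= N)%N -> 0 < beta k /\ 0 <= gamma k <= 1) ->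
  exists y, GS_output I (@p_ps R) (@theta_ps R) beta gamma T N x0 y.
Proof.
move=> hS Xx0 hbg.
pose xu k (s : V * V * V) := (1 - gamma k) *: s.2 + gamma k *: s.1.1.
have /choice[next hnext] : forall ks : nat * (V * V * V), exists out,
    (1 <= ks.1 <= N)%N -> X ks.2.1.1 -> X ks.2.2 ->
    PS I (@p_ps R) (@theta_ps R) (l_f I (xu ks.1 ks.2)) ks.2.1.1 (beta ks.1)
      (T ks.1) out.
  move=> [k s].
  have [[k0 Xx Xb]|nX] := pselect [/\ (1 <= k <= N)%N, X s.1.1 & X s.2].
    have [b0 g01] := hbg k k0.
    have Xxu : X (xu k s) by exact: (convex_setE _ _ _ _ (convex_dom H)).
    by have [out hout] := PS_exists _ _ _ (T k) hS Xxu Xx b0; exists out.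
  by exists (x0, x0) => /= k0 Xx Xb; case: nX.
pose st := fix st k := if k is j.+1 then
  (next (k, st j), (1 - gamma k) *: (st j).2 + gamma k *: (next (k, st j)).2)
  else ((x0, x0), x0).
have Xst k : (k <= N)%N -> X (st k).1.1 /\ X (st k).2.
  elim: k => //= k IH kN; have [Xx Xb] := IH (ltnW kN).
  have [b0 g01] := hbg k.+1 kN.
  have Xxu := convex_setE _ _ _ _ (convex_dom H) Xb Xx g01.
  move: (hnext (k.+1, st k) kN Xx Xb); case: (next _) => v w hPS.
  have [Xv Xw _] := PS_bound I H _ _ _ _ _ _ Xxu Xx b0 hPS.
  by split=> //; exact: (convex_setE _ _ _ _ (convex_dom H)).
exists (st N).2, (fun k => (st k).1.1), (fun k => (st k).1.2), (fun k => (st k).2).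
split=> // -[//|k] kN; split=> //; have [Xx Xb] := Xst k (ltnW kN).
by have := hnext (k.+1, st k) kN Xx Xb; rewrite /xu/=; case: (next _).
Qed.

Lemma GS_recursion (beta gamma : nat -> R) (T : nat -> nat) N x0 y :
  X x0 ->
  (forall k, (1 <= k <= N)%N ->
    [/\ 0 < beta k, 0 <= gamma k <= 1, (0 < T k)%N
      & L I * gamma k <= beta k * nu I]) ->
  GS_output I (@p_ps R) (@theta_ps R) beta gamma T N x0 y ->
  X y /\ forall z, X z -> exists x xbar : nat -> V,
    [/\ forall k, (k <= N)%N -> X (x k), y = xbar N &
    forall k, (k < N)%N ->
      Psi I (xbar k.+1) - Psi I z <=
      (1 - gamma k.+1) * (Psi I (xbar k) - Psi I z) +
      gamma k.+1 * (beta k.+1 * inv_onemP (T k.+1)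
          * (prox I (x k) z - prox I (x k.+1) z)
        + 4 * M I ^+ 2 / (nu I * beta k.+1 * ((T k.+1)%:R + 3)))].
Proof.
move=> Xx0 hpar [x [xt [xbar [x00 xb0 step ->]]]].
have XX k : (k <= N)%N -> X (x k) /\ X (xbar k).
  elim: k => [_|k IH kN]; first by rewrite x00 xb0.
  have [Xx Xb] := IH (ltnW kN); have [b0 g01 T0 Lg] := hpar k.+1 kN.
  have [hPS ->] := step k.+1 kN.
  by have [] := GS_step I H _ _ _ _ x0 _ _ _ Xb Xx g01 b0 T0 Lg hPS Xx0.
split=> [|z Xz]; first by case: (XX N).
exists x, xbar; split=> // [k /XX[]//|k kN].
have [Xx Xb] := XX k (ltnW kN); have [b0 g01 T0 Lg] := hpar k.+1 kN.
have [hPS ->] := step k.+1 kN.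
by have [] := GS_step I H _ _ _ _ z _ _ _ Xb Xx g01 b0 T0 Lg hPS Xz.
Qed.

Lemma sgh_evals_le (T : nat -> nat) N (c : R) :
  (forall k, (1 <= k <= N)%N -> (T k)%:R <= c) ->
  (sgh_evals T N)%:R <= N%:R * c.
Proof.
move=> hT; rewrite /sgh_evals natr_sum.
apply: (@le_trans _ _ (\sum_(1 <= k < N.+1) c)).
  by apply: ler_sum_nat => k; exact: hT.
by rewrite sumr_const_nat subn1 mulr_natl.
Qed.

Lemma gradf_evalsE N : gradf_evals N = N.
Proof. by rewrite /gradf_evals sum_nat_const_nat subn1 muln1. Qed.

Lemma eps_solution_of_le y (eps : R) : X y ->
  (forall z, X z -> Psi I y - Psi I z <= eps) -> eps_solution I eps y.
Proof.
move=> Xy hy; split=> //; rewrite lerBlDr addrC -lerBlDr; apply: lb_le_inf.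
  by exists (Psi I y), y.
by move=> _ [z Xz <-]; have := hy z Xz; lra.
Qed.

Lemma GS_complexity_of_rate (DX : R) (beta gamma : nat -> nat -> R)
    (T : nat -> nat -> nat) : 0 < DX ->
  (forall N x0, (0 < N)%N -> X x0 -> exists y,
    GS_output I (@p_ps R) (@theta_ps R) (beta N) (gamma N) (T N) N x0 y) ->
  (forall N x0 y, (0 < N)%N -> X x0 ->
    GS_output I (@p_ps R) (@theta_ps R) (beta N) (gamma N) (T N) N x0 y ->
    X y /\ forall z, X z ->
      N%:R ^+ 2 * (Psi I y - Psi I z) <= 36 * (L I * DX / nu I)) ->
  (forall N, (0 < N)%N -> (sgh_evals (T N) N)%:R <=
    N%:R + 8 / 5 * (M I ^+ 2 * nu I * N%:R ^+ 4 / (DX * L I ^+ 2))) ->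
  GS_complexity I (@p_ps R) (@theta_ps R) beta gamma T
    (fun eps => 7 * Num.sqrt (L I * DX / (nu I * eps)))
    (fun eps => 4000 * (M I ^+ 2 * DX / (nu I * eps ^+ 2)
                       + Num.sqrt (L I * DX / (nu I * eps)))).
Proof.
move=> D0 hex hrate hT.
have L0 := L_gt0 H; have nu0 := nu_gt0 H.
exists (L I * DX / nu I) => [|eps e0 eQ]; first by rewrite divr_gt0// mulr_gt0.
set r := L I * DX / (nu I * eps).
have r1 : 1 < r.
  by rewrite ltr_pdivlMr ?mulr_gt0// mul1r; move: eQ; rewrite ltr_pdivlMr//; lra.
have rE : L I * DX / nu I = r * eps by rewrite /r; field; rewrite !gt_eqF.
set s := Num.sqrt r.
have s2 : s ^+ 2 = r by rewrite sqr_sqrtr; lra.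
have s1 : 1 <= s by rewrite -[leLHS]sqrtr1 ler_wsqrtr; lra.
have s60 : 0 <= 6 * s by lra.
pose N := nceil (6 * s).
have Nge : 6 * s <= N%:R := nceil_ge _ s60.
have Nle : N%:R <= 7 * s by have := nceil_lt _ s60; rewrite -/N; lra.
have N0 : (0 < N)%N by apply: nceil_gt0; lra.
exists N; split=> //.
- move=> x0 Xx0; split; first exact: hex.
  move=> y /(hrate _ _ _ N0 Xx0)[Xy hy]; apply: eps_solution_of_le => // z Xz.
  have := hy z Xz; rewrite rE; set d := _ - _; rewrite leNgt => h; rewrite leNgt.
  apply: contra h => de; have : 36 * r <= N%:R ^+ 2 by rewrite -s2; nra.
  have : 0 < r by lra.
  nra.
- by rewrite gradf_evalsE.
- apply: le_trans (hT N N0) _.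
  have N4 : N%:R ^+ 4 <= 2401 * r ^+ 2.
    have -> : 2401 * r ^+ 2 = (7 * s) ^+ 4 by rewrite -s2; ring.
    by rewrite lerXn2r// nnegrE; lra.
  have K0 : 0 <= M I ^+ 2 * nu I / (DX * L I ^+ 2).
    by rewrite divr_ge0// mulr_ge0 ?sqr_ge0// ltW.
  have E1 : M I ^+ 2 * nu I * N%:R ^+ 4 / (DX * L I ^+ 2)
     = M I ^+ 2 * nu I / (DX * L I ^+ 2) * N%:R ^+ 4 by rewrite mulrAC.
  have E2 : M I ^+ 2 * DX / (nu I * eps ^+ 2)
     = M I ^+ 2 * nu I / (DX * L I ^+ 2) * r ^+ 2.
    by rewrite /r; field; rewrite !gt_eqF.
  rewrite E1 E2; have := ler_wpM2l K0 N4.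
  have : 0 <= M I ^+ 2 * nu I / (DX * L I ^+ 2) * r ^+ 2.
    by rewrite mulr_ge0// sqr_ge0.
  lra.
Qed.

End Runs.

Section Schedules.
Context {R : realType} {n : nat} (I : instance R n) (DX : R).
Hypothesis H : standing_assumptions I.
Hypothesis hS : subproblems_solvable I (@p_ps R).
Hypothesis D0 : 0 < DX.
Hypothesis proxD : forall x y, dom I x -> dom I y -> prox I x y <= DX.
Local Notation X := (dom I).

Let L0 : 0 < L I := L_gt0 H.
Let M0 : 0 < M I := M_gt0 H.
Let nu0 : 0 < nu I := nu_gt0 H.

Let Dt1_gt0 : 0 < Dt1 I DX.
Proof. by rewrite divr_gt0 ?mulr_gt0. Qed.

Let Dt2_gt0 : 0 < Dt2 I DX.
Proof. by rewrite divr_gt0 ?mulr_gt0. Qed.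

Let DL1_gt0 : 0 < Dt1 I DX * L I ^+ 2.
Proof. exact: mulr_gt0 Dt1_gt0 (exprn_gt0 _ L0). Qed.

Let DL2_gt0 : 0 < Dt2 I DX * L I ^+ 2.
Proof. exact: mulr_gt0 Dt2_gt0 (exprn_gt0 _ L0). Qed.

Lemma T1_arg_ge0 N k :
  0 <= M I ^+ 2 * N%:R * k%:R ^+ 2 / (Dt1 I DX * L I ^+ 2).
Proof.
apply: divr_ge0 (ltW DL1_gt0).
by rewrite mulr_ge0 ?sqr_ge0// mulr_ge0// sqr_ge0.
Qed.

Lemma T1_gt0 N k : (0 < N)%N -> (0 < k)%N -> (0 < T1 I DX N k)%N.
Proof.
move=> N0 k0; apply: nceil_gt0.
by rewrite divr_gt0// !mulr_gt0 ?exprn_gt0 ?ltr0n.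
Qed.

Lemma T2_arg_gt0 k : 0 < M I ^+ 2 * (k + 1)%N%:R ^+ 3 / (Dt2 I DX * L I ^+ 2).
Proof. by rewrite addn1 divr_gt0// mulr_gt0 ?exprn_gt0. Qed.

Lemma T2_gt0 k : (0 < T2 I DX k)%N.
Proof. exact: nceil_gt0 _ (T2_arg_gt0 k). Qed.

Lemma schedule1_admissible N k : (1 <= k <= N)%N ->
  [/\ 0 < beta1 I k, 0 <= @gamma1 R k <= 1, (0 < T1 I DX N k)%N
    & L I * @gamma1 R k <= beta1 I k * nu I].
Proof.
move=> /andP[k0 kN]; have k1 : 1 <= k%:R :> R by rewrite ler1n.
rewrite /beta1 /gamma1 natrD T1_gt0 ?(leq_trans k0)//; split=> //.
- by rewrite divr_gt0 ?mulr_gt0//; lra.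
- by rewrite divr_ge0 ?addr_ge0//= ler_pdivrMr; lra.
- have -> : 2 * L I / (nu I * k%:R) * nu I = L I * (2 / k%:R).
    by field; rewrite !gt_eqF//; lra.
  by rewrite ler_pM2l// ler_pM2l// lef_pV2 ?posrE; lra.
Qed.

Lemma beta2E k : beta2 I DX k
  = 9 * L I / (2 * nu I * (k%:R + 1) * inv_onemP (T2 I DX k)).
Proof.
rewrite /beta2 natrD.
have -> : 1 - Pseq (p_ps R) (T2 I DX k) = (@inv_onemP R (T2 I DX k))^-1.
  have P0 := inv_onemP_ge1 (R := R) (T2 I DX k).
  rewrite -[LHS](@mulfK _ (inv_onemP (T2 I DX k))); last by rewrite gt_eqF//; lra.
  by rewrite onem_Pseq ?T2_gt0// mul1r.
have P0 := inv_onemP_ge1 (R := R) (T2 I DX k); have k0 := ler0n R k.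
by field; rewrite !gt_eqF//; lra.
Qed.

Lemma schedule2_admissible k : (1 <= k)%N ->
  [/\ 0 < beta2 I DX k, 0 <= @gamma2 R k <= 1, (0 < T2 I DX k)%N
    & L I * @gamma2 R k <= beta2 I DX k * nu I].
Proof.
move=> k0; have k1 : 1 <= k%:R :> R by rewrite ler1n.
have P1 := inv_onemP_ge1 (R := R) (T2 I DX k).
have P2 := @inv_onemP_le R _ (T2_gt0 k).
rewrite beta2E /gamma2 natrD T2_gt0; split=> //.
- by rewrite divr_gt0 ?mulr_gt0//; lra.
- by rewrite divr_ge0 ?addr_ge0//= ler_pdivrMr; lra.
- set P := inv_onemP _ in P1 P2 *.
  have -> : 9 * L I / (2 * nu I * (k%:R + 1) * P) * nu I
      = L I * (9 / (2 * (k%:R + 1) * P)).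
    by field; rewrite !gt_eqF//; lra.
  rewrite ler_pM2l// ler_pdivrMr; last by lra.
  have Pk : 0 < 2 * (k%:R + 1) * P by rewrite !mulr_gt0//; lra.
  by rewrite mulrAC ler_pdivlMr//; nra.
Qed.

Lemma rate1 N x0 y : (0 < N)%N -> X x0 ->
  GS_output I (@p_ps R) (@theta_ps R) (beta1 I) (@gamma1 R) (T1 I DX N) N x0 y ->
  X y /\ forall z, X z ->
    N%:R ^+ 2 * (Psi I y - Psi I z) <= 36 * (L I * DX / nu I).
Proof.
move=> N0 Xx0 /(GS_recursion _ H _ _ _ _ _ _ Xx0 (schedule1_admissible N)).
move=> [Xy hy]; split=> // z /[dup] Xz /hy[x [xbar [Xx -> rec]]] {hy}.
pose Q := L I * DX / nu I.
have Q0 : 0 < Q by rewrite divr_gt0 ?mulr_gt0.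
pose d k := Psi I (xbar k) - Psi I z; pose V k := prox I (x k) z.
have V0 k : (k <= N)%N -> 0 <= V k <= DX.
  by move=> /Xx Xk; rewrite prox_ge0//= proxD.
pose K := 4 * L I / nu I.
have K0 : 0 < K by rewrite divr_gt0 ?mulr_gt0.
have NR : 1 <= N%:R :> R by rewrite ler1n.
(* Summation by parts: [c] ranges up to the coefficient [1 / (1 - P_(T_k))] of
   [V k], so the induction step may switch to the smaller next coefficient. *)
have inv k : (k <= N)%N -> forall c : R, 0 <= c <= 3 / 2 ->
    ((0 < k)%N -> c <= inv_onemP (T1 I DX N k)) ->
    k%:R * (k%:R + 1) * d k + K * c * V k <= 6 * Q + 6 * Q * (k%:R / N%:R).
  elim: k => [_|k IH kN] c /andP[c0 c32] hc.
    rewrite !mul0r mulr0 add0r addr0.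
    have -> : 6 * Q = K * (3 / 2 * DX) by rewrite /K /Q; field; rewrite gt_eqF.
    rewrite -mulrA ler_pM2l//; have := V0 0%N isT; nra.
  set a := inv_onemP (T1 I DX N k.+1) : R.
  have T0 : (0 < T1 I DX N k.+1)%N by exact: T1_gt0.
  have a1 : 1 <= a by exact: inv_onemP_ge1.
  have a32 : a <= 3 / 2 by exact: inv_onemP_le.
  have ca : c <= a by exact: hc.
  have := IH (ltnW kN) a; rewrite a32 (le_trans ler01 a1) => /(_ isT) {}IH.
  have {}IH : k%:R * (k%:R + 1) * d k + K * a * V k
      <= 6 * Q + 6 * Q * (k%:R / N%:R).
    apply: IH => k0; apply: inv_onemP_nincr; rewrite T1_gt0//=.
    apply: le_nceil; first exact: T1_arg_ge0.
    rewrite ler_pM2r ?invr_gt0//.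
    rewrite ler_pM2l ?mulr_gt0 ?exprn_gt0 ?ltr0n//.
    by rewrite lerXn2r ?nnegrE// ler_nat.
  have k1 : 0 < k%:R + 1 :> R by rewrite ltr_wpDl.
  have kk : 0 < (k%:R + 1) * (k%:R + 2) :> R by rewrite mulr_gt0//; lra.
  have := rec k kN; rewrite -/(d k) -/(d k.+1) -/(V k) -/(V k.+1) -/a.
  set tau := (T1 I DX N k.+1)%:R.
  have tau0 : 0 <= tau :> R by [].
  rewrite -(ler_pM2l kk) /gamma1 /beta1 natrD -natr1.
  rewrite [leRHS](_ : _ = k%:R * (k%:R + 1) * d k + K * a * (V k - V k.+1)
      + 4 * (M I ^+ 2 * (k%:R + 1) ^+ 2 / (L I * (tau + 3)))); last first.
    by rewrite /K; field; rewrite !gt_eqF//; lra.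
  have htau : 4 * (M I ^+ 2 * (k%:R + 1) ^+ 2 / (L I * (tau + 3)))
      <= 6 * Q / N%:R.
    have -> : 6 * Q / N%:R = 4 * (Dt1 I DX * L I / N%:R).
      by rewrite /Q /Dt1; field; rewrite !gt_eqF//; lra.
    rewrite ler_pM2l// ler_pdivrMr; last by rewrite mulr_gt0//; lra.
    have := nceil_ge _ (T1_arg_ge0 N k.+1); rewrite -/tau -natr1.
    rewrite ler_pdivrMr// => h.
    have -> : Dt1 I DX * L I / N%:R * (L I * (tau + 3))
        = Dt1 I DX * L I ^+ 2 * (tau + 3) / N%:R by field; rewrite gt_eqF//; lra.
    rewrite ler_pdivlMr; last by lra.
    have := DL1_gt0.
    nra.
  move=> h; have := V0 k.+1 kN => /andP[Vk0 _].
  have h1 : K * c * V k.+1 <= K * a * V k.+1 by rewrite ler_wpM2r// ler_pM2l.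
  rewrite -natr1.
  have -> : 6 * Q * ((k%:R + 1) / N%:R)
      = 6 * Q * (k%:R / N%:R) + 6 * Q / N%:R.
    by field; rewrite gt_eqF//; lra.
  move: h h1 htau IH; set W := 4 * _; lra.
have := inv N (leqnn N) 0; rewrite lexx divr_ge0// => /(_ isT).
rewrite mulr0 mul0r addr0 divff ?gt_eqF//; last by lra.
move=> /(_ (fun _ => le_trans ler01 (inv_onemP_ge1 _))).
rewrite -/(d N) -/Q; have [d0|d0] := leP 0 (d N); nra.
Qed.

Lemma rate2 N x0 y : (0 < N)%N -> X x0 ->
  GS_output I (@p_ps R) (@theta_ps R) (beta2 I DX) (@gamma2 R) (T2 I DX) N x0 y ->
  X y /\ forall z, X z ->
    N%:R ^+ 2 * (Psi I y - Psi I z) <= 36 * (L I * DX / nu I).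
Proof.
move=> N0 Xx0 hGS.
have [|Xy hy] := GS_recursion _ H _ _ _ _ _ _ Xx0 _ hGS.
  by move=> k /andP[k0 _]; exact: schedule2_admissible.
split=> // z /[dup] Xz /hy[x [xbar [Xx -> rec]]] {hy hGS}.
pose Q := L I * DX / nu I.
have Q0 : 0 < Q by rewrite divr_gt0 ?mulr_gt0.
pose d k := Psi I (xbar k) - Psi I z; pose V k := prox I (x k) z.
have V0 k : (k <= N)%N -> 0 <= V k <= DX.
  by move=> /Xx Xk; rewrite prox_ge0//= proxD.
pose K := 27 * L I / (2 * nu I).
have K0 : 0 < K by rewrite divr_gt0 ?mulr_gt0.
have inv k : (k <= N)%N ->
    k%:R * (k%:R + 1) * (k%:R + 2) * d k + K * k%:R * V k <= 135 / 4 * Q * k%:R.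
  elim: k => [_|k IH kN]; first by rewrite !(mul0r, mulr0) addr0.
  set P := inv_onemP (T2 I DX k.+1) : R.
  have P1 : 1 <= P by exact: inv_onemP_ge1.
  have P32 : P <= 3 / 2 by exact/inv_onemP_le/T2_gt0.
  have {}IH := IH (ltnW kN).
  have k0 := ler0n R k.
  have kk : 0 < (k%:R + 1) * (k%:R + 2) * (k%:R + 3) :> R.
    by rewrite !mulr_gt0//; lra.
  have := rec k kN; rewrite -/(d k) -/(d k.+1) -/(V k) -/(V k.+1) beta2E -/P.
  set tau := (T2 I DX k.+1)%:R.
  have tau0 : 0 <= tau :> R by [].
  rewrite -(ler_pM2l kk) /gamma2 natrD -natr1.
  rewrite [leRHS](_ : _ = k%:R * (k%:R + 1) * (k%:R + 2) * d k
      + K * (k%:R + 1) * (V k - V k.+1)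
      + 8 / 3 * P
        * (M I ^+ 2 * ((k%:R + 1) * (k%:R + 2) ^+ 2) / (L I * (tau + 3))));
    last by rewrite /K; field; rewrite !gt_eqF//; lra.
  have htau : M I ^+ 2 * ((k%:R + 1) * (k%:R + 2) ^+ 2) / (L I * (tau + 3))
      <= 81 / 16 * Q.
    have -> : 81 / 16 * Q = Dt2 I DX * L I.
      by rewrite /Q /Dt2; field; rewrite gt_eqF.
    rewrite ler_pdivrMr; last by rewrite mulr_gt0//; lra.
    have := nceil_ge _ (ltW (T2_arg_gt0 k.+1)); rewrite -/tau ler_pdivrMr//.
    have -> : (k.+1 + 1)%N%:R = k%:R + 2 :> R by rewrite natrD -natr1; ring.
    have : M I ^+ 2 * ((k%:R + 1) * (k%:R + 2) ^+ 2) <= M I ^+ 2 * (k%:R + 2) ^+ 3.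
      by rewrite ler_wpM2l ?sqr_ge0// exprS ler_wpM2r ?sqr_ge0//; lra.
    have := DL2_gt0.
    lra.
  have htau0 : 0 <= M I ^+ 2 * ((k%:R + 1) * (k%:R + 2) ^+ 2) / (L I * (tau + 3)).
    apply: divr_ge0; last by rewrite mulr_ge0 ?ltW//; lra.
    by rewrite mulr_ge0 ?sqr_ge0// mulr_ge0 ?sqr_ge0//; lra.
  move: htau htau0; set W := _ / (L I * _) => htau htau0 h.
  have PW : 8 / 3 * P * W <= 81 / 4 * Q by nra.
  have /andP[_ Vk] := V0 k (ltnW kN).
  have KV : K * V k <= 27 / 2 * Q.
    have -> : 27 / 2 * Q = K * DX by rewrite /K /Q; field; rewrite gt_eqF.
    by rewrite ler_pM2l.
  move: h IH PW KV; lra.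
have NR : 1 <= N%:R :> R by rewrite ler1n.
have /andP[VN _] := V0 N (leqnn N).
have := inv N (leqnn N); rewrite -/(d N) -/Q.
have : 0 <= K * N%:R * V N by exact: mulr_ge0 (mulr_ge0 (ltW K0) (ler0n _ _)) VN.
move: (d N) => D hK hD.
have h2 : N%:R * ((N%:R + 1) * (N%:R + 2) * D) <= N%:R * (135 / 4 * Q) by lra.
have {h2} : (N%:R + 1) * (N%:R + 2) * D <= 135 / 4 * Q.
  by rewrite ler_pM2l in h2 => //; lra.
have [d0|d0] := leP 0 D; nra.
Qed.

Lemma sgh_evals1 N : (0 < N)%N -> (sgh_evals (T1 I DX N) N)%:R <=
  N%:R + 8 / 5 * (M I ^+ 2 * nu I * N%:R ^+ 4 / (DX * L I ^+ 2)).
Proof.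
move=> N0; have NR : 1 <= N%:R :> R by rewrite ler1n.
pose A := M I ^+ 2 / (Dt1 I DX * L I ^+ 2).
have A0 : 0 < A by rewrite divr_gt0// exprn_gt0.
apply: (@le_trans _ _ (N%:R * (A * N%:R ^+ 3 + 1))).
  apply: sgh_evals_le => k /andP[k0 kN].
  apply: le_trans (ltW (nceil_lt _ (T1_arg_ge0 N k))) _; rewrite lerD2r.
  have -> : M I ^+ 2 * N%:R * k%:R ^+ 2 / (Dt1 I DX * L I ^+ 2)
      = A * (N%:R * k%:R ^+ 2) by rewrite /A; field; rewrite !gt_eqF.
  rewrite ler_pM2l// [leRHS]exprS ler_wpM2l//.
  by rewrite lerXn2r ?nnegrE// ler_nat.
have -> : A = 2 / 3 * (M I ^+ 2 * nu I / (DX * L I ^+ 2)).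
  by rewrite /A /Dt1; field; rewrite !gt_eqF.
have : 0 <= M I ^+ 2 * nu I / (DX * L I ^+ 2) * N%:R ^+ 4.
  by rewrite !mulr_ge0 ?invr_ge0 ?mulr_ge0 ?exprn_ge0 ?ltW//; lra.
by rewrite (mulrAC _ _ (_^-1)) mulrDr mulr1 (exprS _ 3); lra.
Qed.

Lemma sgh_evals2 N : (0 < N)%N -> (sgh_evals (T2 I DX) N)%:R <=
  N%:R + 8 / 5 * (M I ^+ 2 * nu I * N%:R ^+ 4 / (DX * L I ^+ 2)).
Proof.
move=> N0; have NR : 1 <= N%:R :> R by rewrite ler1n.
pose A := M I ^+ 2 / (Dt2 I DX * L I ^+ 2).
have A0 : 0 < A by rewrite divr_gt0// exprn_gt0.
apply: (@le_trans _ _ (N%:R * (A * (2 * N%:R) ^+ 3 + 1))).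
  apply: sgh_evals_le => k /andP[k0 kN].
  apply: le_trans (ltW (nceil_lt _ (ltW (T2_arg_gt0 k)))) _; rewrite lerD2r.
  rewrite mulrAC -/A ler_pM2l// -natrM.
  by rewrite lerXn2r ?nnegrE// ler_nat; lia.
have -> : A = 16 / 81 * (M I ^+ 2 * nu I / (DX * L I ^+ 2)).
  by rewrite /A /Dt2; field; rewrite !gt_eqF.
have : 0 <= M I ^+ 2 * nu I / (DX * L I ^+ 2) * N%:R ^+ 4.
  by rewrite !mulr_ge0 ?invr_ge0 ?mulr_ge0 ?exprn_ge0 ?ltW//; lra.
by rewrite (mulrAC _ _ (_^-1)) mulrDr mulr1 exprMn (exprS _ 3); lra.
Qed.

End Schedules.

Theorem corollary2 (R : realType) :
  exists C1 C2 : R, [/\ 0 < C1, 0 < C2 &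
    forall (n : nat) (I : instance R n) (DX : R),
      standing_assumptions I ->
      subproblems_solvable I (@p_ps R) ->
      0 < DX ->
      (forall x y, dom I x -> dom I y -> prox I x y <= DX) ->
      let grad_bound eps := C1 * Num.sqrt (L I * DX / (nu I * eps)) in
      let subgrad_bound eps :=
        C2 * (M I ^+ 2 * DX / (nu I * eps ^+ 2)
              + Num.sqrt (L I * DX / (nu I * eps))) in
      GS_complexity I (@p_ps R) (@theta_ps R)
        (fun _ => beta1 I) (fun _ => @gamma1 R) (fun N => T1 I DX N)
        grad_bound subgrad_bound
      /\
      (bounded_set (dom I) ->
       GS_complexity I (@p_ps R) (@theta_ps R)
         (fun _ => beta2 I DX) (fun _ => @gamma2 R) (fun _ => T2 I DX)
         grad_bound subgrad_bound)].
Proof.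
exists 7, 4000; split; [by rewrite ltr0n|by rewrite ltr0n|].
move=> n I DX H hS D0 proxD grad_bound subgrad_bound.
split=> [|_]; apply: GS_complexity_of_rate => //.
- move=> N x0 _ Xx0; apply: GS_exists => // k kN.
  by have [] := schedule1_admissible I DX H D0 N k kN.
- exact: rate1.
- exact: sgh_evals1.
- move=> N x0 _ Xx0; apply: GS_exists => // k /andP[k0 _].
  by have [] := schedule2_admissible I DX H D0 k k0.
- exact: rate2.
- by move=> N; exact: sgh_evals2.
Qed.
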